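(* Let $[S,f],[S',f']\in\mathcal{T}_1$ with $S=\mathbb{C}/\Lambda$ and $S'=\mathbb{C}/\Lambda'$ flat tori of area $1$ (with the metrics induced from the Euclidean metric on $\mathbb{C}$). Let $\{\omega_1,\omega_2\}$ be a basis of $\Lambda$ and let $\{\zeta_1,\zeta_2\}$ be the corresponding basis of $\Lambda'$, i.e. $\zeta_j$ is the image of $\omega_j$ under the isomorphism $\Lambda\cong\pi_1(S)\to\pi_1(S')\cong\Lambda'$ induced by $f'^{-1}\circ f$. Let $\tilde\psi:\mathbb{C}\to\mathbb{C}$ be the unique ($\mathbb{R}$-)affine map with $\tilde\psi(0)=0$, $\tilde\psi(\omega_1)=\zeta_1$, $\tilde\psi(\omega_2)=\zeta_2$, and let $\psi:S\to S'$ be the map to which it descends (which is homotopic to $f'^{-1}\circ f$). Then $\psi$ realizes the minimal Lipschitz constant in its homotopy class: $\mathcal{L}(\psi)\le\mathcal{L}(\varphi)$ for every Lipschitz map $\varphi:S\to S'$ homotopic to $f'^{-1}\circ f$.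
   Context: Teichmüller space of the torus: fix the oriented torus $S_1=\mathbb{C}/(\mathbb{Z}+i\mathbb{Z})$. $\mathcal{T}_1$ is the set of pairs $(S,f)$, with $S$ a closed Riemann surface of genus $1$ and $f:S\to S_1$ an orientation-preserving homeomorphism (the marking), modulo the relation $(S,f)\sim(S',f')$ iff there is a conformal homeomorphism $k:S\to S'$ with $f'\circ k$ homotopic to $f$. Every such $S$ is conformally equivalent to some $\mathbb{C}/\Lambda$ of area $1$, $\Lambda\subset\mathbb{C}$ a lattice, and is given the flat metric induced from $\mathbb{C}$. The fundamental group of $\mathbb{C}/\Lambda$ is identified with the deck group $\Lambda$. Lipschitz constant: for a homeomorphism $\varphi:S\to S'$, with $d_S,d_{S'}$ the distances of the flat metrics, $\mathcal{L}(\varphi)=\sup_{x\neq y}\frac{d_{S'}(\varphi(x),\varphi(y))}{d_S(x,y)}$; when this is finite $\varphi$ is called a Lipschitz map. *)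

(* Defs.v *)
From HB Require Import structures.
From mathcomp Require Import all_boot all_order all_algebra.
From mathcomp Require Import generic_quotient complex.
From mathcomp Require Import all_classical all_reals all_analysis.

Set Implicit Arguments.
Unset Strict Implicit.
Unset Printing Implicit Defensive.

Import Order.TTheory GRing.Theory Num.Theory.
Import numFieldNormedType.Exports.

Local Open Scope classical_set_scope.
Local Open Scope ring_scope.
Local Open Scope complex_scope.
Local Open Scope quotient_scope.

(* The usual topology of the plane: that of [R[i]] as a numFieldType. *)
HB.instance Definition _ (R : rcfType) := NormedModule.copy R[i] R[i]^o.

Section FlatTori.
Variable R : realType.
Local Notation C := R[i].

(* The norm of [R[i]] is itself [R[i]]-valued; this is its real version. *)
Definition cmod (z : C) : R := Normc.normc z.

Definition is_basis (L : set C) (w1 w2 : C) : Prop :=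
  (forall a b : R, a%:C * w1 + b%:C * w2 = 0 -> a = 0 /\ b = 0) /\
  L = [set z | exists m n : int, z = w1 *~ m + w2 *~ n].

Record lattice := Lattice {
  lattice_set :> set C;
  lattice_has_basis : exists w1 w2, is_basis lattice_set w1 w2 }.

(* The area of [C / L] is that of a fundamental parallelogram; it does not
   depend on the basis. *)
Definition has_area (L : lattice) (a : R) : Prop :=
  exists w1 w2, is_basis L w1 w2 /\ a = `|complex.Re w1 * complex.Im w2 - complex.Im w1 * complex.Re w2|.

Definition congruent (L : lattice) : rel C := fun z w => `[< lattice_set L (z - w) >].

Lemma congruent_refl L : reflexive (congruent L).
Proof.
move=> z; apply/asboolP; rewrite subrr.
by have [w1 [w2 [_ ->]]] := lattice_has_basis L; exists 0, 0; rewrite !mulr0z addr0.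
Qed.

Lemma congruent_sym L : symmetric (congruent L).
Proof.
have opp z w : lattice_set L (z - w) -> lattice_set L (w - z).
  have [w1 [w2 [_ ->]]] := lattice_has_basis L => -[m [n e]].
  by exists (- m), (- n); rewrite !mulrNz -opprD -e opprB.
by move=> z w; apply/asboolP/asboolP; exact: opp.
Qed.

Lemma congruent_trans L : transitive (congruent L).
Proof.
move=> y x z /asboolP + /asboolP + ; rewrite /congruent.
have [w1 [w2 [_ ->]]] := lattice_has_basis L => -[m [n e]] [m' [n' e']].
apply/asboolP; exists (m + m'), (n + n').
by rewrite !mulrzDr addrACA -e -e' addrA subrK.
Qed.

Canonical congruent_equiv L := EquivRel (congruent L)
  (congruent_refl L) (congruent_sym L) (congruent_trans (L := L)).

Definition torus (L : lattice) : topologicalType :=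
  quotient_topology {eq_quot congruent_equiv L}.

Definition tproj (L : lattice) (z : C) : torus L :=
  (\pi_({eq_quot congruent_equiv L}) z)%qT.

(* The distance of the flat metric: geodesics are projections of segments, so
   it is the least distance between points of the plane above [x] and [y]. *)
Definition flat_dist (L : lattice) (x y : torus L) : R :=
  inf [set cmod (z - w) | z in tproj L @^-1` [set x] & w in tproj L @^-1` [set y]].

Record homeo (X Y : topologicalType) := Homeo {
  homeo_fun :> X -> Y;
  homeo_inv : Y -> X;
  homeo_funK : cancel homeo_fun homeo_inv;
  homeo_invK : cancel homeo_inv homeo_fun;
  homeo_fun_continuous : continuous homeo_fun;
  homeo_inv_continuous : continuous homeo_inv }.

Definition homotopic (X Y : topologicalType) (f g : X -> Y) : Prop :=
  exists H : X * R -> Y,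
    [/\ {within [set: X] `*` `[0%R, 1%R], continuous H},
        forall x, H (x, 0) = f x & forall x, H (x, 1) = g x].

Definition is_lift (L L' : lattice) (F : C -> C) (f : torus L -> torus L') :=
  forall z, f (tproj L z) = tproj L' (F z).

(* The closed curve [c] on [0, 1] has winding number 1 around the origin:
   it avoids 0 and its argument increases by [2 pi]. *)
Definition winds_once (c : R -> C) : Prop :=
  exists theta : R -> R,
    [/\ {within `[0%R, 1%R], continuous theta},
        theta 1 = theta 0 + 2 * pi &
        forall t, 0 <= t <= 1 ->
          c t != 0 /\ c t = (cmod (c t))%:C * (cos (theta t) +i* sin (theta t))].

(* [F] has local degree 1 at every point: the image of a positively oriented
   circle around [z] winds once, positively, around [F z]. *)
Definition preserves_orientation (F : C -> C) : Prop :=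
  forall (z : C) (r : R), 0 < r ->
    winds_once (fun t =>
      F (z + r%:C * (cos (2 * pi * t) +i* sin (2 * pi * t))) - F z).

(* The projections to the tori are orientation preserving local
   homeomorphisms, so that the orientation behaviour of a map between tori is
   that of any of its continuous lifts. *)
Definition orientation_preserving (L L' : lattice)
    (f : torus L -> torus L') : Prop :=
  exists F : C -> C,
    [/\ continuous F, is_lift F f & preserves_orientation F].

Lemma gaussian_basis :
  is_basis [set z : C | exists m n : int, z = m%:~R +i* n%:~R] 1 'i.
Proof.
split=> [a b|].
  by rewrite mulr1 => /eqP; simpc; rewrite eq_complex /= => /andP[/eqP -> /eqP ->].
have E (m n : int) : 1 *~ m + 'i *~ n = m%:~R +i* n%:~R :> C.
  rewrite -[X in _ + X]mulrzl -!(rmorph_int (real_complex R)) /=.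
  by simpc.
by apply/seteqP; split=> z /= [m [n ->]]; exists m, n; rewrite E.
Qed.

Definition gaussian : lattice :=
  Lattice (ex_intro _ _ (ex_intro _ _ gaussian_basis)).

(* A lattice [L] and a marking [f] of [C / L] represent the point [[C / L, f]]
   of the Teichmueller space of the torus. *)
Record marking (L : lattice) := Marking {
  marking_homeo :> homeo (torus L) (torus gaussian);
  marking_oriented : orientation_preserving marking_homeo }.

(* The identification of the fundamental group of [C / L] with [L]: the loop
   [gamma] corresponds to the deck transformation [z |-> z + w], which sends the
   starting point of a lift of [gamma] to its end point. *)
Definition loop_class (L : lattice) (gamma : R -> torus L) (w : C) : Prop :=
  exists c : R -> C,
    [/\ {within `[0%R, 1%R], continuous c},
        forall t, 0 <= t <= 1 -> tproj L (c t) = gamma t &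
        c 1 = c 0 + w].

(* [w'] is the image of [w] under the homomorphism of fundamental groups
   induced by [g]. As these groups are abelian, base points play no role. *)
Definition pi1_image (L L' : lattice) (g : torus L -> torus L') (w w' : C) :=
  forall gamma, loop_class gamma w -> loop_class (g \o gamma) w'.

Definition lipschitz_const (L L' : lattice) (phi : torus L -> torus L') : \bar R :=
  ereal_sup [set e | exists x y : torus L, x <> y /\
    e = (flat_dist (phi x) (phi y) / flat_dist x y)%:E].

Definition lipschitz_map (L L' : lattice) (phi : torus L -> torus L') : Prop :=
  (lipschitz_const phi < +oo)%E.

(* [Rcomplex R] is [R[i]] as a real vector space. *)
Definition real_affine (f : C -> C) : Prop :=
  exists (l : {linear Rcomplex R -> Rcomplex R}) (b : C), forall z, f z = l z + b.

End FlatTori.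

(* Main.v *)
Require Import Defs.
From HB Require Import structures.
From mathcomp Require Import all_boot all_order all_algebra.
From mathcomp Require Import generic_quotient complex.
From mathcomp Require Import all_classical all_reals all_analysis.
From mathcomp Require Import ring lra.
Set Implicit Arguments.
Unset Strict Implicit.
Unset Printing Implicit Defensive.
Import Order.TTheory GRing.Theory Num.Theory.
Import numFieldNormedType.Exports.
Local Open Scope classical_set_scope.
Local Open Scope ring_scope.

(** The minimality of [psi] is a statement about closed geodesics. Let [A] be the
    linear lift of [psi], and let [phi] be homotopic to the change of marking
    [g]. Then [phi] sends the closed geodesic of a lattice vector [w] to a loop
    whose lifts end at their starting point translated by [A w]. If [phi] is
    [K]-Lipschitz, then [|A w| <= K |w|] for every [w] in the lattice
    ([lipschitz_period]); lattice directions being dense, this bounds the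
    operator norm of [A] by [K] ([lattice_bound]), and the operator norm bounds
    the Lipschitz constant of [psi] ([lift_lipschitz]).

    No lift of [phi] is constructed. The homotopy from [phi] to [g], evaluated
    along the geodesic, is sampled on a fine grid of the unit square. Neighbouring
    grid points differ by short displacement vectors, which cancel around each
    square because a short vector of a lattice vanishes; hence the total
    displacement along the [g]-row, which is the period [A w], equals the total
    displacement along the [phi]-row, which the Lipschitz bound controls
    ([grid_row_displacement]).

    It remains to know that [g] has a continuous lift [G] and that its periods
    [G l - G 0] map one lattice onto the other. The definition of orientation
    provides continuous lifts of the markings, and makes them injective since
    winding numbers are taken around avoided points. A continuous lift of a
    homeomorphism of tori is open and onto ([homeo_lift_open],
    [homeo_lift_surj]), so the lifts of the markings are homeomorphisms of the
    plane and [G] is the composite of one with the inverse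
    of the other ([change_of_marking_lift]). Then [z1],
    [z2] are the periods of [w1], [w2] ([pi1_image_period]), they form a basis
    ([period_basis]), and [A], which has the same periods as [G], descends to a
    homeomorphism homotopic to [g] along straight segments
    ([lifts_homotopic]). *)

(** * The plane *)

Section Plane.
Variable R : realType.
Local Notation C := R[i].
Implicit Types (z u v w : C) (a b : R).

Lemma cmod_ge0 z : 0 <= cmod z.
Proof. by case: z => a b; exact: sqrtr_ge0. Qed.

Lemma cmod0 : cmod 0 = 0 :> R. Proof. exact: Normc.normc0. Qed.

Lemma cmod_eq0 z : cmod z = 0 -> z = 0. Proof. exact: Normc.eq0_normc. Qed.

Lemma cmodD u v : cmod (u + v) <= cmod u + cmod v.
Proof. exact: (@le_normcD R u v). Qed.

Lemma cmodN z : cmod (- z) = cmod z.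
Proof. exact: (@normcN R z). Qed.

Lemma cmodB u v : cmod (u - v) = cmod (v - u).
Proof. by rewrite -cmodN opprB. Qed.

Lemma cmodD3 u v w : cmod (u - w) <= cmod (u - v) + cmod (v - w).
Proof. by rewrite (le_trans _ (cmodD _ _))// addrA subrK. Qed.

Lemma cmodM u v : cmod (u * v) = cmod u * cmod v.
Proof. exact: Normc.normcM. Qed.

Lemma cmod_real a : cmod a%:C%C = `|a|.
Proof. by rewrite /cmod /= expr0n addr0 sqrtr_sqr. Qed.

Lemma normE z : `|z| = (cmod z)%:C%C.
Proof. by case: z => a b; rewrite normc_def. Qed.

Lemma mulr_realE a z : a%:C%C * z = (a * complex.Re z +i* (a * complex.Im z))%C.
Proof. by case: z => x y; simpc. Qed.

Lemma Re_cmod z : `|complex.Re z| <= cmod z.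
Proof. by have := normc_ge_Re z; rewrite normE lecR. Qed.

Lemma Im_cmod z : `|complex.Im z| <= cmod z.
Proof.
case: z => a b /=; rewrite -sqrtr_sqr /cmod /= ler_wsqrtr//.
by rewrite lerDr sqr_ge0.
Qed.

(** The balls of the topology of [R[i]] have radii in [R[i]]; real ones suffice. *)
Lemma nbhs_cmodP z (U : set C) :
  nbhs z U <-> exists2 e : R, 0 < e & forall w, cmod (w - z) < e -> U w.
Proof.
split=> [/(@nbhs_normP _ C z U)|].
  move=> [[e i]] /=; rewrite ltcE /= => /andP[/eqP -> e0] eU; exists e => // w we.
  by apply: eU; rewrite /ball_/= normE -cmodN opprB ltcR.
move=> [e e0 eU]; apply/(@nbhs_normP _ C z U); exists e%:C%C; first by rewrite /= ltcR.
by move=> w; rewrite /ball_/= normE ltcR -cmodN opprB; exact: eU.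
Qed.

Lemma continuous_cmodP (T : topologicalType) (f : T -> C) (x : T) :
  {for x, continuous f} <->
  forall e : R, 0 < e -> \forall y \near x, cmod (f y - f x) < e.
Proof.
split=> [cf e e0|cf U /nbhs_cmodP[e e0 eU]].
  have : nbhs (f x) [set w | cmod (w - f x) < e] by apply/nbhs_cmodP; exists e.
  exact: cf.
by apply: filterS (cf e e0) => y ye; exact: eU.
Qed.

Lemma near_dist (V : normedModType R) (x : V) (P : V -> Prop) :
  (\forall y \near x, P y) <->
  exists2 d : R, 0 < d & forall y, `|y - x| < d -> P y.
Proof.
rewrite nbhs_normP; split=> -[d d0 dP]; exists d => // y.
  by move=> yd; apply: dP; rewrite /ball_/= distrC.
by rewrite /ball_/= distrC; exact: dP.
Qed.

Lemma cst_plus_line_continuous u v : continuous (fun t : R => u + t%:C%C * v).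
Proof.
move=> t; apply/continuous_cmodP => e e0; apply/near_dist.
have v0 : 0 < cmod v + 1 by rewrite ltr_wpDl ?cmod_ge0.
exists (e / (cmod v + 1)); first exact: divr_gt0.
move=> s st; rewrite opprD addrACA subrr add0r -mulrBl -rmorphB cmodM cmod_real.
rewrite ltr_pdivlMr// in st; apply: le_lt_trans st.
by rewrite ler_wpM2l// lerDl.
Qed.

(** The determinant of two plane vectors. *)
Definition cross u v : R := complex.Re u * complex.Im v - complex.Im u * complex.Re v.

(** The linear map sending [w1] to [z1] and [w2] to [z2], by Cramer's formulas
    for the coordinates of [v]; meaningful when [cross w1 w2 != 0]. *)
Definition change_basis w1 w2 z1 z2 v : C :=
  (cross v w2 / cross w1 w2)%:C%C * z1 + (cross w1 v / cross w1 w2)%:C%C * z2.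

Lemma crossDl u v w : cross (u + v) w = cross u w + cross v w.
Proof. by case: u v w => ? ? [? ?] [? ?]; rewrite /cross/=; ring. Qed.

Lemma crossDr u v w : cross w (u + v) = cross w u + cross w v.
Proof. by case: u v w => ? ? [? ?] [? ?]; rewrite /cross/=; ring. Qed.

Lemma crossZl a u v : cross (a%:C%C * u) v = a * cross u v.
Proof. by rewrite mulr_realE /cross/=; ring. Qed.

Lemma crossZr a u v : cross u (a%:C%C * v) = a * cross u v.
Proof. by rewrite mulr_realE /cross/=; ring. Qed.

Lemma crossxx u : cross u u = 0.
Proof. by rewrite /cross mulrC subrr. Qed.

Lemma cross_cmod u v : `|cross u v| <= 2 * (cmod u * cmod v).
Proof.
rewrite (le_trans (ler_normB _ _))// !normrM mulr_natl mulr2n.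
by rewrite lerD// ler_pM// ?Re_cmod ?Im_cmod.
Qed.

Lemma indep_cross w1 w2 :
  (forall a b : R, a%:C%C * w1 + b%:C%C * w2 = 0 -> a = 0 /\ b = 0) <->
  cross w1 w2 != 0.
Proof.
case: w1 w2 => [x1 y1] [x2 y2]; rewrite /cross/=; split.
  move=> indep; apply/eqP => D0.
  have [|e1 e2] := indep y2 (- y1).
    rewrite !mulr_realE/=; apply/eqP; rewrite eq_complex/=; apply/andP; split;
      apply/eqP; [apply: etrans D0|]; ring.
  have [|e3 e4] := indep x2 (- x1).
    rewrite !mulr_realE/=; apply/eqP; rewrite eq_complex/=; apply/andP; split;
      apply/eqP; [|apply: etrans (etrans (congr1 -%R D0) (oppr0 _))]; ring.
  have [|/eqP + _] := indep 1 1; last by rewrite oner_eq0.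
  move: e2 e4 => /eqP; rewrite oppr_eq0 => /eqP -> /eqP; rewrite oppr_eq0 => /eqP ->.
  by rewrite e1 e3 !mul1r addr0.
move=> D0 a b; rewrite !mulr_realE/= => -[e1 e2].
have : a * (x1 * y2 - y1 * x2) = y2 * (a * x1 + b * x2) - x2 * (a * y1 + b * y2).
  by ring.
have : b * (x1 * y2 - y1 * x2) = x1 * (a * y1 + b * y2) - y1 * (a * x1 + b * x2).
  by ring.
rewrite e1 e2 !mulr0 subrr.
by move=> /eqP; rewrite mulf_eq0 (negbTE D0) orbF => /eqP -> /eqP;
  rewrite mulf_eq0 (negbTE D0) orbF => /eqP ->.
Qed.

Lemma change_basis_id w1 w2 v : cross w1 w2 != 0 -> change_basis w1 w2 w1 w2 v = v.
Proof.
case: w1 w2 v => [x1 y1] [x2 y2] [x y]; rewrite /change_basis !mulr_realE /cross/=.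
move=> D0; apply/eqP; rewrite eq_complex/=.
by apply/andP; split; apply/eqP; field; rewrite mulrC [y1 * _]mulrC in D0 *.
Qed.

Variables w1 w2 z1 z2 : C.
Hypothesis w_indep : cross w1 w2 != 0.
Local Notation A := (change_basis w1 w2 z1 z2).

Lemma change_basisD u v : A (u + v) = A u + A v.
Proof.
by rewrite /change_basis crossDl crossDr !mulrDl !rmorphD !mulrDl addrACA.
Qed.

Lemma change_basisZ a v : A (a%:C%C * v) = a%:C%C * A v.
Proof.
rewrite /change_basis crossZl crossZr -!(mulrA a) !(rmorphM _ a).
by rewrite -!(mulrA a%:C%C) -mulrDr.
Qed.

Lemma change_basis1 : A w1 = z1.
Proof.
rewrite /change_basis divff// mul1r /cross [complex.Re w1 * _]mulrC subrr.
by rewrite mul0r mul0r addr0.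
Qed.

Lemma change_basis2 : A w2 = z2.
Proof.
rewrite /change_basis divff// mul1r /cross [complex.Re w2 * _]mulrC subrr.
by rewrite mul0r mul0r add0r.
Qed.

Lemma change_basis0 : A 0 = 0.
Proof. by have := change_basisZ 0 0; rewrite !mul0r. Qed.

Lemma change_basisN v : A (- v) = - A v.
Proof. by apply/eqP; rewrite -addr_eq0 -change_basisD addNr change_basis0. Qed.

Lemma change_basisB u v : A (u - v) = A u - A v.
Proof. by rewrite change_basisD change_basisN. Qed.

Lemma change_basis_bound : exists2 K : R, 0 <= K & forall v, cmod (A v) <= K * cmod v.
Proof.
have D0 : 0 < `|cross w1 w2| by rewrite normr_gt0.
exists (2 * (cmod w2 * cmod z1 + cmod w1 * cmod z2) / `|cross w1 w2|).
  by rewrite divr_ge0// mulr_ge0// addr_ge0// mulr_ge0// cmod_ge0.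
move=> v; rewrite (le_trans (cmodD _ _))// !cmodM !cmod_real !normf_div.
rewrite [leRHS]mulrAC ![_ / _ * _]mulrAC -mulrDl ler_wpM2r// ?invr_ge0//.
rewrite (_ : 2 * _ * _ = 2 * (cmod v * cmod w2) * cmod z1 + 2 * (cmod w1 * cmod v) * cmod z2).
  by rewrite lerD// ler_wpM2r ?cmod_ge0// cross_cmod.
ring.
Qed.

Lemma change_basis_continuous : continuous A.
Proof.
have [K K0 AK] := change_basis_bound.
move=> z; apply/continuous_cmodP => e e0; apply/nbhs_cmodP.
have K1 : 0 < K + 1 by rewrite ltr_wpDl.
exists (e / (K + 1)); first exact: divr_gt0.
move=> w; rewrite ltr_pdivlMr// mulrC -change_basisB; apply: le_lt_trans.
by rewrite (le_trans (AK _))// ler_wpM2r ?cmod_ge0// lerDl.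
Qed.

Lemma change_basis_unique (l : C -> C) :
  (forall u v, l (u + v) = l u + l v) -> (forall a v, l (a%:C%C * v) = a%:C%C * l v) ->
  l w1 = z1 -> l w2 = z2 -> l = A.
Proof.
move=> lD lZ l1 l2; apply/funext => v.
by rewrite -{1}(change_basis_id v w_indep) lD !lZ l1 l2.
Qed.

End Plane.

(** * Lattices and flat tori *)

Lemma mulrz_real (R : realType) (z : R[i]) (n : int) :
  z *~ n = (n%:~R : R)%:C%C * z.
Proof. by rewrite -[LHS]mulrzl -(rmorph_int (real_complex R)). Qed.

Section Torus.
Variables (R : realType) (L : lattice R).
Local Notation C := R[i].
Implicit Types (z u v w l : C).

Lemma basis_cross (S : set C) w1 w2 : is_basis S w1 w2 -> cross w1 w2 != 0.
Proof. by move=> [/indep_cross]. Qed.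

Lemma basis_mem w1 w2 : is_basis L w1 w2 -> lattice_set L w1 /\ lattice_set L w2.
Proof.
move=> [_ ->]; split; first by exists 1, 0; rewrite mulr1z mulr0z addr0.
by exists 0, 1; rewrite mulr1z mulr0z add0r.
Qed.

Lemma lattice0 : lattice_set L 0.
Proof. by have := congruent_refl L 0 => /asboolP; rewrite subr0. Qed.

Lemma latticeN l : lattice_set L l -> lattice_set L (- l).
Proof.
move=> Ll; have := congruent_sym L l 0; rewrite /congruent subr0 sub0r.
by move=> e; apply/asboolP; rewrite -e; apply/asboolP.
Qed.

Lemma latticeB l l' : lattice_set L l -> lattice_set L l' -> lattice_set L (l - l').
Proof.
move=> Ll Ll'; have := @congruent_trans _ L 0 l l'; rewrite /congruent subr0 sub0r.
by move=> e; apply/asboolP/e; apply/asboolP => //; exact: latticeN.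
Qed.

Lemma latticeD l l' : lattice_set L l -> lattice_set L l' -> lattice_set L (l + l').
Proof. by move=> Ll Ll'; rewrite -[l']opprK; apply/latticeB/latticeN. Qed.

Lemma latticeMz l (n : int) : lattice_set L l -> lattice_set L (l *~ n).
Proof.
move=> Ll; have nat_case (k : nat) : lattice_set L (l *+ k).
  by elim: k => [|k IH]; rewrite ?mulr0n ?mulrS; [exact: lattice0|exact: latticeD].
by case: n => n; rewrite -?pmulrn ?NegzE ?mulrNz; [|apply: latticeN]; exact: nat_case.
Qed.

(** The integer coordinates of a lattice vector are quotients of determinants,
    hence less than 1 when the vector is short. *)
Lemma lattice_discrete :
  exists2 m : R, 0 < m & forall l, lattice_set L l -> cmod l < m -> l = 0.
Proof.
have [w1 [w2 bw]] := lattice_has_basis L.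
have D0 := basis_cross bw; case: bw => _ LE.
pose K := 2 * (cmod w1 + cmod w2) + 1.
have K0 : 0 < K by rewrite ltr_wpDl// mulr_ge0// addr_ge0// cmod_ge0.
exists (`|cross w1 w2| / K); first by rewrite divr_gt0// normr_gt0.
move=> l; rewrite LE => -[m [n lE]]; rewrite ltr_pdivlMr// => lK.
have lE' : l = (m%:~R : R)%:C%C * w1 + (n%:~R : R)%:C%C * w2.
  by rewrite lE -!mulrz_real.
have int0 (k : int) (c : C) : `|k%:~R * cross w1 w2| <= 2 * (cmod l * cmod c) ->
    cmod c <= cmod w1 + cmod w2 -> k = 0.
  move=> kl cw; apply/eqP; rewrite -(@intr_eq0 R); apply: contraT => k0.
  have k1 : 1 <= `|k%:~R : R| by rewrite -intr_norm (ler_int R 1) -gtz0_ge1 normr_gt0 -(@intr_eq0 R).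
  have : `|cross w1 w2| < `|cross w1 w2|.
    apply: le_lt_trans lK; rewrite (le_trans (ler_peMl _ k1))// -normrM.
    rewrite (le_trans kl)// mulrCA ler_wpM2l ?cmod_ge0// /K.
    by rewrite (le_trans (_ : _ <= 2 * (cmod w1 + cmod w2)))// ?ler_pM2l// lerDl.
  by rewrite ltxx.
have m0 : m = 0.
  apply: (int0 m w2); last by rewrite lerDr cmod_ge0.
  by rewrite -[X in `|X|]addr0 -(mulr0 n%:~R) -(crossxx w2) -!crossZl -crossDl -lE' cross_cmod.
have n0 : n = 0.
  apply: (int0 n w1); last by rewrite lerDl cmod_ge0.
  rewrite -[X in `|X|]add0r -(mulr0 m%:~R) -(crossxx w1) -!crossZr -crossDr -lE'.
  by rewrite [cmod l * _]mulrC cross_cmod.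
by rewrite lE m0 n0 !mulr0z addr0.
Qed.

Lemma tproj_eq z w : tproj L z = tproj L w <-> lattice_set L (z - w).
Proof.
have e := @eqmodP _ (congruent_equiv L) z w.
by split=> [/e/asboolP|Lzw]; last exact/e/asboolP.
Qed.

Lemma tprojD z l : lattice_set L l -> tproj L (z + l) = tproj L z.
Proof. by move=> Ll; apply/tproj_eq; rewrite addrAC subrr add0r. Qed.

Lemma tproj_surj (x : torus L) : exists z, tproj L z = x.
Proof. by exists (generic_quotient.repr x); rewrite /tproj generic_quotient.reprK. Qed.

Lemma tproj_continuous : continuous (tproj L).
Proof. exact: pi_continuous. Qed.

(** The saturation of an open set is a union of translates of it. *)
Lemma tproj_open z (U : set C) : nbhs z U -> nbhs (tproj L z) (tproj L @` U).
Proof.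
move=> zU.
have [V [oV Vz] VU] : exists2 V, open_nbhs z V & V `<=` U by move: zU; rewrite nbhsE.
rewrite nbhsE; exists (tproj L @` V); last exact: image_subset.
split; last by exists z.
suff : open (tproj L @^-1` (tproj L @` V)) by [].
rewrite openE => w [v Vv /tproj_eq Lvw].
have /nbhs_cmodP[e e0 eV] : nbhs v V by exact: open_nbhs_nbhs.
apply/nbhs_cmodP; exists e => // w' w'e.
exists (w' + (v - w)); last exact: tprojD.
apply: eV; have -> : w' + (v - w) - v = w' - w by ring.
by [].
Qed.

Lemma flat_dist_ge0 (x y : torus L) : 0 <= flat_dist x y.
Proof.
rewrite /flat_dist; have [->|/set0P ne] := eqVneq
  [set cmod (z - w) | z in tproj L @^-1` [set x] & w in tproj L @^-1` [set y]] set0.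
  by rewrite inf0.
by apply: lb_le_inf => // _ [z _ [w _ <-]]; exact: cmod_ge0.
Qed.

Lemma flat_dist_le z w : flat_dist (tproj L z) (tproj L w) <= cmod (z - w).
Proof.
apply: ge_inf; last by exists z => //; exists w.
by exists 0 => _ [u _ [v _ <-]]; exact: cmod_ge0.
Qed.

Lemma le_flat_dist (x y : torus L) (k : R) :
  (forall z w, tproj L z = x -> tproj L w = y -> k <= cmod (z - w)) ->
  k <= flat_dist x y.
Proof.
move=> k_le; apply: lb_le_inf; last by move=> _ [z zx [w wy <-]]; exact: k_le.
have [z zx] := tproj_surj x; have [w wy] := tproj_surj y.
by exists (cmod (z - w)); exists z => //; exists w.
Qed.

(** The projection is isometric below half the length of the shortest
    lattice vectors. *)
Lemma flat_dist_local (m : R) z w :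
  (forall l, lattice_set L l -> cmod l < m -> l = 0) -> 2 * cmod (z - w) < m ->
  flat_dist (tproj L z) (tproj L w) = cmod (z - w).
Proof.
move=> disc zw; apply/eqP; rewrite eq_le flat_dist_le/=.
apply: le_flat_dist => z' w' /tproj_eq zz' /tproj_eq ww'.
rewrite leNgt; apply/negP => lt_zw.
have e : z' - w' = z - w.
  apply/eqP; rewrite -subr_eq0; apply/eqP/disc.
    have -> : z' - w' - (z - w) = (z' - z) - (w' - w) by ring.
    exact: latticeB.
  rewrite (le_lt_trans (cmodD _ _))// cmodN (le_lt_trans _ zw)//.
  by rewrite mulr_natl mulr2n lerD2r ltW.
by rewrite e ltxx in lt_zw.
Qed.

End Torus.

(** * Maps between tori and their lifts *)

Section Descent.
Variables (R : realType) (L M : lattice R).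
Local Notation C := R[i].
Implicit Types (z w l : C) (F : C -> C) (f g : torus L -> torus M).

(** The map of tori covered by [F], provided [F] maps congruent points to
    congruent points. *)
Definition descend F : torus L -> torus M := fun x => tproj M (F (generic_quotient.repr x)).

Lemma descend_lift F :
  (forall z l, lattice_set L l -> lattice_set M (F (z + l) - F z)) ->
  is_lift F (descend F).
Proof.
move=> Fl z; apply/tproj_eq.
set w := generic_quotient.repr _; have /tproj_eq : tproj L w = tproj L z.
  by rewrite /w /tproj generic_quotient.reprK.
by move=> /(Fl z); rewrite addrCA subrr addr0.
Qed.

Lemma is_lift_inj F f g : is_lift F f -> is_lift F g -> f = g.
Proof.
move=> Ff Fg; apply/funext => x; have [z <-] := tproj_surj x.
by rewrite Ff Fg.
Qed.

Lemma lift_continuous F f : continuous F -> is_lift F f -> continuous f.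
Proof.
move=> cF Ff; apply/quotient_continuous.
rewrite (_ : _ \o _ = tproj M \o F); last by apply/funext => z; exact: Ff.
by move=> z; apply: continuous_comp; [exact: cF|exact: tproj_continuous].
Qed.

(** The product of [tproj L] with the identity is open, hence a quotient map. *)
Lemma lift_homotopy_continuous (Q : C * R -> C) (H : torus L * R -> torus M) :
  continuous Q -> (forall z t, H (tproj L z, t) = tproj M (Q (z, t))) ->
  continuous H.
Proof.
move=> cQ HQ [x t] U; have [z <-] := tproj_surj x.
rewrite HQ => MU; have : nbhs (Q (z, t)) (tproj M @^-1` U) by exact: tproj_continuous.
move=> /(cQ (z, t))[[V W]]/= [Vz Wt] VW.
exists (tproj L @` V, W); first by split => //; exact: tproj_open.
by move=> [_ s] [/= [w Vw <-] Ws]; rewrite /= HQ; exact: (VW (w, s)).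
Qed.

End Descent.

Section ConstantLift.
Variables (R : realType) (M : lattice R).
Local Notation C := R[i].

(** A continuous path in a discrete set is constant. *)
Lemma lattice_valued_constant (D : R -> C) :
  {within `[0, 1], continuous D} ->
  (forall t, 0 <= t <= 1 -> lattice_set M (D t)) -> D 1 = D 0.
Proof.
move=> cD DM; have [m m0 disc] := lattice_discrete M.
have conn : connected (D @` `[0, 1]).
  by apply: connected_continuous_connected => //; exact: segment_connected.
have i0 : `[0, 1]%classic (0 : R) by rewrite /= in_itv/= lexx ler01.
have i1 : `[0, 1]%classic (1 : R) by rewrite /= in_itv/= lexx ler01.
have D01 : [set D 0] = D @` `[0, 1].
  apply: conn; first by exists (D 0).
    exists [set z | cmod (z - D 0) < m].
      rewrite openE => z zm; apply/nbhs_cmodP.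
      exists (m - cmod (z - D 0)); first by rewrite subr_gt0.
      by move=> w; rewrite ltrBrDr; apply: le_lt_trans; exact: cmodD3.
    apply/seteqP; split=> [_ ->|_ [[t t01 <-] /= tm]].
      by split; [exists 0|rewrite /= subrr cmod0].
    apply/eqP; rewrite -subr_eq0; apply/eqP/disc => //.
    by apply: latticeB; apply: DM => //; rewrite ?lexx ?ler01//; move: t01; rewrite /= in_itv.
  exists [set D 0].
    by apply: accessible_closed_set1; apply: hausdorff_accessible; exact: norm_hausdorff.
  by apply/seteqP; split=> [_ ->|_ [_ ->]]//; split => //; exists 0.
have : (D @` `[0, 1]) (D 1) by exists 1.
by rewrite -D01.
Qed.

End ConstantLift.

Section EquivariantLift.
Variables (R : realType) (L M : lattice R) (f : torus L -> torus M) (F : R[i] -> R[i]).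
Hypotheses (F_cont : continuous F) (Ff : is_lift F f).
Local Notation C := R[i].

Lemma lift_period_mem (z l : C) : lattice_set L l -> lattice_set M (F (z + l) - F z).
Proof. by move=> Ll; apply/tproj_eq; rewrite -!Ff tprojD. Qed.

(** The period [F (z + l) - F z] depends continuously on [z] and takes its
    values in a lattice. *)
Lemma lift_period (z l : C) : lattice_set L l -> F (z + l) = F z + (F l - F 0).
Proof.
move=> Ll; pose D (t : R) := F (l + t%:C%C * z) - F (0 + t%:C%C * z).
have D10 : D 1 = D 0.
  apply: (@lattice_valued_constant _ M); last first.
    by move=> t _; rewrite /D add0r [l + _]addrC; exact: lift_period_mem.
  apply: continuous_subspaceT => t.
  by apply: continuousB; apply: continuous_comp;
    [exact: cst_plus_line_continuous|exact: F_cont|exact: cst_plus_line_continuous|exact: F_cont].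
move: D10; rewrite /D !mul1r !mul0r !addr0 add0r [l + z]addrC => <-.
by rewrite [RHS]addrC subrK.
Qed.

End EquivariantLift.

(** A continuous lift of a homeomorphism of tori is an open map onto
    the plane. *)
Section HomeoLift.
Variables (R : realType) (L M : lattice R) (h : homeo (torus L) (torus M)).
Variable F : R[i] -> R[i].
Hypotheses (F_cont : continuous F) (Fh : is_lift F h).
Local Notation C := R[i].

(** Near [F z], a point [y] lies above the image by [h] of a point of [U]; as
    [F] of the latter is congruent to [y] and close to it, both are equal. *)
Lemma homeo_lift_open (z : C) (U : set C) : nbhs z U -> nbhs (F z) (F @` U).
Proof.
move=> zU; have [m m0 disc] := lattice_discrete M.
have m20 : 0 < m / 2 by rewrite divr_gt0.
have U'z : nbhs z (U `&` [set w | cmod (F w - F z) < m / 2]).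
  by apply: filterI => //; have /continuous_cmodP := F_cont (x := z); exact.
have hV : nbhs (homeo_inv h (tproj M (F z)))
    (tproj L @` (U `&` [set w | cmod (F w - F z) < m / 2])).
  by rewrite -Fh homeo_funK; exact: tproj_open.
have : nbhs (F z) [set y | (tproj L @` (U `&` [set w | cmod (F w - F z) < m / 2]))
    (homeo_inv h (tproj M y))].
  exact: (tproj_continuous (homeo_inv_continuous hV)).
move=> /nbhs_cmodP[e e0 eV]; apply/nbhs_cmodP; exists (Num.min e (m / 2)).
  by rewrite lt_min e0.
move=> y; rewrite lt_min => /andP[/eV[w [Uw /= wz] wy] yz].
exists w => //; apply/eqP; rewrite -subr_eq0; apply/eqP/disc.
  by apply/tproj_eq; rewrite -Fh wy homeo_invK.
rewrite (le_lt_trans (cmodD3 _ (F z) _))// (splitr m) ltrD//.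
by rewrite -cmodN opprB.
Qed.

(** The image of [F] is open and closed along every line. *)
Lemma homeo_lift_surj (y : C) : exists z, F z = y.
Proof.
(* Surjectivity of [h] gives a value of [F] congruent to any given point. *)
have near_image y0 : exists z n, lattice_set M n /\ F z = y0 + n.
  have [z zy] := tproj_surj (homeo_inv h (tproj M y0)).
  exists z, (F z - y0); split; last by rewrite addrC subrK.
  by apply/tproj_eq; rewrite -Fh zy homeo_invK.
(* Whether a point is in the image is a locally constant condition: near [z],
   [F] attains all values near [y0 + n], and those points of the image can be
   moved by a period of [F] equal to [n]. *)
have image_clopen y0 : nbhs y0 [set y' | (exists z, F z = y') <-> (exists z, F z = y0)].
  have [z [n [Mn zy]]] := near_image y0.
  have /nbhs_cmodP[e e0 eF] : nbhs (F z) (F @` setT).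
    by apply: homeo_lift_open; exact: filterT.
  apply/nbhs_cmodP; exists e => // y' y'y0.
  have {eF}[z'' _ z''E] : (F @` setT) (y' + n).
    by apply: eF; rewrite zy opprD addrACA subrr addr0.
  have transfer y1 y2 z1 z2 : F z1 = y1 + n -> F z2 = y2 + n ->
      (exists z, F z = y1) -> exists z, F z = y2.
    move=> z1E z2E [z1' z1'E].
    have Ll : lattice_set L (z1 - z1').
      apply/tproj_eq; apply: (can_inj (homeo_funK h)).
      by rewrite !Fh z1E z1'E tprojD.
    have per v := lift_period F_cont Fh v Ll.
    have rE : F (z1 - z1') - F 0 = n.
      by have := per z1'; rewrite addrC subrK z1E z1'E => /addrI.
    by exists (z2 - (z1 - z1')); have := per (z2 - (z1 - z1'));
      rewrite subrK rE z2E => /addIr.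
  by split; [exact: transfer z''E zy|exact: transfer zy z''E].
pose p (t : R) := F 0 + t%:C%C * (y - F 0).
have p_near t : nbhs t [set s | (exists z, F z = p s) <-> (exists z, F z = p t)].
  exact: (cst_plus_line_continuous (image_clopen (p t))).
pose I := [set t : R | exists z, F z = p t].
have Iopen : open I.
  by rewrite openE => t It; apply: filterS (p_near t) => s sI; exact/sI.
have Iclosed : closed I.
  rewrite -openC openE => t nIt; apply: filterS (p_near t) => s sI /sI.
  exact: nIt.
have I01 : `[0, 1]%classic `&` I = `[0, 1]%classic.
  apply: segment_connected; [exists 0|by exists I|by exists I].
  by split; [rewrite /= in_itv/= lexx ler01|exists 0; rewrite /= /p mul0r addr0].
have : `[0, 1]%classic (1 : R) by rewrite /= in_itv/= lexx ler01.
by rewrite -I01 => -[_ [z zE]]; exists z; rewrite zE /p mul1r [LHS]addrC subrK.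
Qed.

End HomeoLift.

(** * Changes of marking *)

Section Orientation.
Variable R : realType.
Local Notation C := R[i].

Lemma polar_form (z : C) : z != 0 -> exists2 t : R, 0 <= t <= 1 &
  z = (cmod z)%:C%C * (cos (2 * pi * t) +i* sin (2 * pi * t))%C.
Proof.
move=> z0; have r0 : cmod z != 0 by apply: contra z0 => /eqP/cmod_eq0 ->.
have r2 : complex.Re z ^+ 2 + complex.Im z ^+ 2 = cmod z ^+ 2.
  by case: (z) => x y; rewrite /cmod /= sqr_sqrtr// addr_ge0// sqr_ge0.
pose a := complex.Re z / cmod z; pose b := complex.Im z / cmod z.
have ab : a ^+ 2 + b ^+ 2 = 1.
  by rewrite !expr_div_n -mulrDl r2 divff// expf_neq0.
have a1 : -1 <= a <= 1.
  by rewrite -ler_norml -(@ler_pXn2r _ 2)// ?nnegrE// expr1n real_normK ?num_real// -ab lerDl sqr_ge0.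
have [th [thc ths th2pi]] : exists th : R,
    [/\ cos th = a, sin th = b & 0 <= th <= 2 * pi].
  have sb : Num.sqrt (1 - a ^+ 2) = `|b| by rewrite -ab addrC addKr sqrtr_sqr.
  have [b0|b0] := leP 0 b.
    exists (acos a); rewrite acosK// sin_acos// sb ger0_norm//; split => //.
    by have := acos_ge0 a1; have := acos_lepi a1; lra.
  exists (- acos a + pi *+ 2).
  rewrite cosD2pi sinD2pi cosN sinN acosK// sin_acos// sb ltr0_norm// opprK.
  by split => //; have := acos_ge0 a1; have := acos_lepi a1; rewrite mulr2n; lra.
have pi2_gt0 : 0 < 2 * pi :> R by rewrite mulr_gt0// pi_gt0.
exists (th / (2 * pi)).
  by rewrite ler_pdivlMr// ler_pdivrMr// mul0r mul1r.
rewrite (_ : 2 * pi * (th / (2 * pi)) = th); last first.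
  by rewrite mulrC divfK// mulf_neq0// gt_eqF// pi_gt0.
rewrite thc ths mulr_realE/= /a /b; case: (z) r0 => x y r0 /=.
by congr (_ +i* _)%C; rewrite mulrC divfK.
Qed.

(** A closed curve with a winding number around a point avoids that point. *)
Lemma preserves_orientation_inj (F : C -> C) :
  preserves_orientation F -> injective F.
Proof.
move=> orF z z' FE; apply/eqP; rewrite eq_sym -subr_eq0; apply: contraT => zz'.
have [t t01 tE] := polar_form zz'.
have r0 : 0 < cmod (z' - z).
  by rewrite lt_def cmod_ge0 andbT; apply: contra zz' => /eqP/cmod_eq0 ->.
have [th [_ _ /(_ t t01)[+ _]]] := orF z _ r0.
by rewrite -tE [z + _]addrC subrK FE subrr eqxx.
Qed.

End Orientation.

Section Period.
Variables (R : realType) (L M : lattice R).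
Variables (g : torus L -> torus M) (G : R[i] -> R[i]).
Hypotheses (G_cont : continuous G) (Gg : is_lift G g).
Local Notation C := R[i].

(** The homomorphism of deck groups induced by a lift. *)
Definition period (l : C) := G l - G 0.

Lemma period_mem (l : C) : lattice_set L l -> lattice_set M (period l).
Proof. by move=> Ll; rewrite /period -[X in G X]add0r; exact: (lift_period_mem Gg). Qed.

Lemma period0 : period 0 = 0. Proof. exact: subrr. Qed.

Lemma periodD (l l' : C) : lattice_set L l' -> period (l + l') = period l + period l'.
Proof. by move=> Ll'; rewrite /period (lift_period G_cont Gg)// addrAC. Qed.

Lemma periodN (l : C) : lattice_set L l -> period (- l) = - period l.
Proof.
by move=> Ll; apply/eqP; rewrite -addr_eq0 -periodD// addNr period0.
Qed.

Lemma periodMz (l : C) (n : int) : lattice_set L l -> period (l *~ n) = period l *~ n.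
Proof.
move=> Ll; have nat_case (k : nat) : period (l *+ k) = period l *+ k.
  by elim: k => [|k IH]; rewrite ?mulr0n ?period0// !mulrSr periodD// IH.
case: n => n; first exact: nat_case.
rewrite NegzE !mulrNz periodN; last exact: (latticeMz n.+1).
by congr (- _); exact: nat_case.
Qed.

(** The homomorphism of fundamental groups induced by [g] is that of deck
    groups induced by its lift. *)
Lemma pi1_image_period (w w' : C) :
  lattice_set L w -> pi1_image g w w' -> w' = period w.
Proof.
move=> Lw gw.
have [|c [c_cont c_lift c1]] := gw (fun t => tproj L (0 + t%:C%C * w)).
  exists (fun t => 0 + t%:C%C * w); split => //.
    by apply: continuous_subspaceT; exact: cst_plus_line_continuous.
  by rewrite mul1r mul0r addr0 add0r.
pose D (t : R) := c t - G (0 + t%:C%C * w).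
have : D 1 = D 0.
  apply: (@lattice_valued_constant _ M).
    have G_line : {within `[0, 1], continuous (fun t : R => G (0 + t%:C%C * w))}.
      apply: continuous_subspaceT => t; apply: continuous_comp; last exact: G_cont.
      exact: cst_plus_line_continuous.
    by move=> t; exact: continuousB (c_cont t) (G_line t).
  by move=> t t01; apply/tproj_eq; rewrite c_lift//= Gg.
rewrite /D /period c1 mul1r mul0r addr0 add0r => e.
have -> : w' = (c 0 + w' - G w) - c 0 + G w by ring.
by rewrite e; ring.
Qed.

End Period.

Section ChangeOfMarking.
Variable R : realType.
Local Notation C := R[i].

Lemma homeo_lift_inverse (L M : lattice R) (h : homeo (torus L) (torus M)) (F : C -> C) :
  continuous F -> is_lift F h -> injective F ->
  exists Fi : C -> C, [/\ continuous Fi, cancel F Fi & cancel Fi F].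
Proof.
move=> cF Fh Finj; have [Fi FiK] := choice (homeo_lift_surj cF Fh).
have FK : cancel F Fi by move=> z; apply: Finj; exact: FiK.
exists Fi; split; [move=> y U yU|exact: FK|exact: FiK].
have := homeo_lift_open cF Fh yU; rewrite FiK.
by apply: filterS => _ [z Uz <-]; rewrite /= FK.
Qed.

(** The lift is [F'^-1 \o F] for lifts [F] and [F'] of the markings. *)
Lemma change_of_marking_lift (L L' : lattice R) (f : marking L) (f' : marking L') :
  exists G : C -> C, [/\ continuous G, is_lift G (homeo_inv f' \o f) &
    forall l', lattice_set L' l' -> exists2 l, lattice_set L l & period G l = l'].
Proof.
have [F [cF Ff /preserves_orientation_inj Finj]] := marking_oriented f.
have [F' [cF' Ff' /preserves_orientation_inj Finj']] := marking_oriented f'.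
have [Fi [cFi FK FiK]] := homeo_lift_inverse cF Ff Finj.
have [Fi' [cFi' FK' FiK']] := homeo_lift_inverse cF' Ff' Finj'.
exists (Fi' \o F); split.
- by move=> z; apply: continuous_comp; [exact: cF|exact: cFi'].
- move=> z; rewrite /= Ff; apply: (can_inj (homeo_funK f')).
  by rewrite homeo_invK Ff' FiK'.
move=> l' Ll'; pose z := Fi (F' (Fi' (F 0) + l')).
have zE : Fi' (F z) = Fi' (F 0) + l' by rewrite /z FiK FK'.
exists z; last by rewrite /period /= zE addrAC subrr add0r.
rewrite -[z]subr0; apply/tproj_eq; apply: (can_inj (homeo_funK f)).
apply: (can_inj (homeo_invK f')).
have lift v : homeo_inv f' (f (tproj L v)) = tproj L' (Fi' (F v)).
  by rewrite Ff; apply: (can_inj (homeo_funK f')); rewrite homeo_invK Ff' FiK'.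
by rewrite !lift zE tprojD.
Qed.

(** A homomorphism of lattices onto [M] sends a basis to a basis. *)
Lemma period_basis (L M : lattice R) (g : torus L -> torus M) (G : C -> C) (w1 w2 : C) :
  continuous G -> is_lift G g ->
  (forall l', lattice_set M l' -> exists2 l, lattice_set L l & period G l = l') ->
  is_basis L w1 w2 -> is_basis M (period G w1) (period G w2).
Proof.
move=> cG Gg G_onto bw; have [Lw1 Lw2] := basis_mem bw.
have period_comb m n : period G (w1 *~ m + w2 *~ n) = period G w1 *~ m + period G w2 *~ n.
  by rewrite (periodD cG Gg) ?(periodMz cG Gg)//; exact: latticeMz.
have ME : lattice_set M = [set z | exists m n : int, z = period G w1 *~ m + period G w2 *~ n].
  apply/seteqP; split=> [l' /G_onto[l]|_ [m [n ->]]].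
    by case: bw => _ -> [m [n ->]] <-; exists m, n.
  rewrite -period_comb; apply: (period_mem Gg).
  by apply: latticeD; exact: latticeMz.
split => //; apply/indep_cross.
have [v1 [v2 bv]] := lattice_has_basis M; have := basis_cross bv.
have := basis_mem bv; rewrite ME.
move: (period G w1) (period G w2) => u1 u2 [[m1 [n1 ->]] [m2 [n2 ->]]].
rewrite !mulrz_real crossDl !crossDr !crossZl !crossZr.
apply: contra => /eqP e.
have -> : cross u2 u1 = - cross u1 u2.
  by rewrite /cross; ring.
by rewrite !crossxx e oppr0 !mulr0 !addr0.
Qed.

End ChangeOfMarking.

(** * Lipschitz maps and their periods *)

Section Uniformity.
Variables (R : realType) (V : normedModType R).

(** A Lebesgue number for a relation that holds near every point of the
    diagonal of a compact set. *)
Lemma compact_locally_uniform (A : set V) (P : V -> V -> Prop) :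
  compact A ->
  (forall x, A x -> exists2 r : R, 0 < r & forall y z, A y -> A z ->
     `|y - x| < r -> `|z - x| < r -> P y z) ->
  exists2 d : R, 0 < d & forall y z, A y -> A z -> `|y - z| < d -> P y z.
Proof.
move=> /compact_near_coveringP cA locP.
pose Q (d : R) (y : V) := forall z, A y -> A z -> `|y - z| < d -> P y z.
have : \forall d \near 0^'+, A `<=` Q d.
  apply: cA => x Ax; have [r r0 rP] := locP x Ax.
  have r20 : 0 < r / 2 by rewrite divr_gt0.
  exists ([set y | `|y - x| < r / 2], [set d : R | d < r / 2]).
    split => /=; last exact: nbhs_right_lt.
    by apply/near_dist; exists (r / 2).
  move=> [y d] [/= yx dr] z Ay Az yz; apply: rP => //.
    by rewrite (lt_trans yx)// ltr_pdivrMr// mulr_natr mulr2n ltrDl.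
  rewrite -(subrK y z) -addrA (le_lt_trans (ler_normD _ _))// (splitr r) ltrD//.
  by rewrite distrC (lt_trans yz).
move=> nearQ; have /filter_ex[d [d0 dQ]] : \forall d \near 0^'+, 0 < d /\ A `<=` Q d.
  by near=> d; split; near: d => //; exact: nbhs_right_gt.
by exists d => // y z Ay Az yz; exact: dQ.
Unshelve. all: by end_near. Qed.

End Uniformity.

Section Displacement.
Variables (R : realType) (M : lattice R).
Local Notation C := R[i].

(** [v] is a displacement from [x] to [y]: the differences of points of the
    plane above [y] and [x] form a coset of [M], which contains [v]. *)
Definition displacement (x y : torus M) (v : C) : Prop :=
  forall a, tproj M a = x -> tproj M (a + v) = y.

Lemma tproj_displacement (a b : C) : displacement (tproj M a) (tproj M b) (b - a).
Proof.
move=> a' /tproj_eq aa'; apply/tproj_eq.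
by have -> : a' + (b - a) - b = a' - a by ring.
Qed.

Lemma displacementD (x y z : torus M) u v :
  displacement x y u -> displacement y z v -> displacement x z (u + v).
Proof. by move=> xy yz a ax; rewrite addrA; apply/yz/xy. Qed.

Lemma displacementB (x y : torus M) u v :
  displacement x y u -> displacement x y v -> lattice_set M (u - v).
Proof.
have [a ax] := tproj_surj x; move=> /(_ a ax) au /(_ a ax); rewrite -au.
move=> /esym/tproj_eq; have -> : a + u - (a + v) = u - v by ring.
by [].
Qed.

Variables (m : R) (disc : forall l, lattice_set M l -> cmod l < m -> l = 0).

Lemma displacement_small (x y : torus M) v :
  displacement x y v -> 2 * cmod v < m -> cmod v = flat_dist x y.
Proof.
move=> xyv vm; have [a ax] := tproj_surj x.
rewrite -ax -(xyv a ax) (flat_dist_local disc) opprD addrA subrr sub0r cmodN//.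
Qed.

(** Consider a closed grid of points of a torus whose neighbours are close to
    each other. Around each square the displacements cancel, since their sum is
    a short vector of the lattice; hence the total displacement along a row does
    not depend on the row. *)
Lemma grid_row_displacement (n p : nat) (k : nat -> nat -> torus M)
    (a b : nat -> nat -> C) :
  (forall i j, (i < n)%N -> (j <= p)%N ->
    displacement (k i j) (k i.+1 j) (a i j) /\ 4 * cmod (a i j) < m) ->
  (forall i j, (i <= n)%N -> (j < p)%N ->
    displacement (k i j) (k i j.+1) (b i j) /\ 4 * cmod (b i j) < m) ->
  (forall j, (j <= p)%N -> k 0%N j = k n j) ->
  \sum_(i < n) a i p = \sum_(i < n) a i 0%N.
Proof.
move=> ha hb closed_rows.
have square i j : (i < n)%N -> (j < p)%N -> a i j.+1 - a i j = b i.+1 j - b i j.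
  move=> ltin ltjp.
  have [da na] := ha i j ltin (ltnW ltjp); have [da' na'] := ha i j.+1 ltin ltjp.
  have [db nb] := hb i j (ltnW ltin) ltjp; have [db' nb'] := hb i.+1 j ltin ltjp.
  apply/eqP; rewrite -subr_eq0; apply/eqP/disc.
    have -> : a i j.+1 - a i j - (b i.+1 j - b i j) =
              (b i j + a i j.+1) - (a i j + b i.+1 j) by ring.
    exact: displacementB (displacementD db da') (displacementD da db').
  rewrite (le_lt_trans (cmodD _ _))// cmodN.
  have := cmodD (a i j.+1) (- a i j); have := cmodD (b i.+1 j) (- b i j).
  by rewrite !cmodN; lra.
have sides j : (j < p)%N -> b n j = b 0%N j.
  move=> ltjp; apply/eqP; rewrite -subr_eq0; apply/eqP/disc.
    have [d _] := hb n j (leqnn _) ltjp; have [d' _] := hb 0%N j isT ltjp.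
    rewrite closed_rows ?(ltnW ltjp)// closed_rows// in d'.
    exact: displacementB d d'.
  have [_ na] := hb n j (leqnn _) ltjp; have [_ nb] := hb 0%N j isT ltjp.
  have := cmodD (b n j) (- b 0%N j); have := cmod_ge0 (b n j); have := cmod_ge0 (b 0%N j).
  by rewrite cmodN; lra.
have rows j : (j <= p)%N -> \sum_(i < n) a i j = \sum_(i < n) a i 0%N.
  elim: j => // j IH ltjp; rewrite -IH ?(ltnW ltjp)//.
  apply/eqP; rewrite -subr_eq0 -sumrB.
  rewrite (eq_bigr (fun i : 'I_n => b i.+1 j - b i j)); last by move=> i _; rewrite square.
  by rewrite -(big_mkord xpredT (fun i => b i.+1 j - b i j)) telescope_sumr// sides// subrr.
exact: rows.
Qed.

End Displacement.

Section LipschitzPeriod.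
Variable R : realType.
Local Notation C := R[i].

Lemma flat_dist_gt0 (L : lattice R) (x y : torus L) : x <> y -> 0 < flat_dist x y.
Proof.
move=> xy; have [m m0 disc] := lattice_discrete L.
have [[z [w [zx wy zw]]]|far] := pselect (exists z w,
    [/\ tproj L z = x, tproj L w = y & 2 * cmod (z - w) < m]).
  rewrite -zx -wy (flat_dist_local disc)// lt_def cmod_ge0 andbT.
  by apply/eqP => /cmod_eq0/eqP; rewrite subr_eq0 => /eqP zwE; apply: xy; rewrite -zx zwE.
apply: (@lt_le_trans _ _ (m / 2)); first by rewrite divr_gt0.
apply: le_flat_dist => z w zx wy; rewrite leNgt; apply/negP => zw.
by apply: far; exists z, w; split => //; rewrite mulrC -ltr_pdivlMr.
Qed.

Lemma lipschitz_constP (L M : lattice R) (phi : torus L -> torus M) (K : R) :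
  0 <= K -> (lipschitz_const phi <= K%:E)%E <->
    forall x y, flat_dist (phi x) (phi y) <= K * flat_dist x y.
Proof.
move=> K0; split=> [leK x y|phiK].
  have [->|/eqP xy] := eqVneq x y.
    have [z <-] := tproj_surj (phi y).
    have := flat_dist_le M z z; rewrite subrr cmod0 => /le_trans; apply.
    by rewrite mulr_ge0// flat_dist_ge0.
  rewrite -ler_pdivrMr ?flat_dist_gt0// -lee_fin (le_trans _ leK)//.
  by apply: ereal_sup_ubound; exists x, y.
apply: ge_ereal_sup => _ [x [y [xy ->]]].
by rewrite lee_fin ler_pdivrMr ?flat_dist_gt0.
Qed.

Variables (L M : lattice R) (phi g : torus L -> torus M) (G : C -> C) (K : R).
Hypotheses (G_cont : continuous G) (Gg : is_lift G g) (phi_g : homotopic R phi g).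
Hypothesis phiK : forall x y, flat_dist (phi x) (phi y) <= K * flat_dist x y.

(** A [K]-Lipschitz map homotopic to [g] bounds the periods of [g]. *)
Lemma lipschitz_period (w : C) :
  0 <= K -> lattice_set L w -> cmod (period G w) <= K * cmod w.
Proof.
move=> K0 Lw; have [H [H_cont H0 H1]] := phi_g.
have [m m0 disc] := lattice_discrete M.
pose line (s : R) := 0 + s%:C%C * w.
have line_cont : continuous line by exact: cst_plus_line_continuous.
pose kappa (p : R * R) := H (tproj L (line p.1), p.2).
have m8 : 0 < m / 8 by rewrite divr_gt0.
have [d d0 dP] : exists2 d : R, 0 < d & forall p q : R * R,
    (`[0, 1]%classic `*` `[0, 1]%classic) p -> (`[0, 1]%classic `*` `[0, 1]%classic) q -> `|p - q| < d ->
    exists2 v, displacement (kappa p) (kappa q) v & 4 * cmod v < m.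
  apply: compact_locally_uniform.
    by apply: compact_setX; exact: segment_compact.
  move=> [s0 t0] [/= Is0 It0]; have [c cE] := tproj_surj (kappa (s0, t0)).
  pose U := tproj M @` [set a | cmod (a - c) < m / 8].
  have Uk : nbhs (kappa (s0, t0)) U.
    by rewrite -cE; apply: tproj_open; apply/nbhs_cmodP; exists (m / 8).
  have /subspace_continuousP/(_ (tproj L (line s0), t0)) := H_cont.
  have ItT : ([set: torus L] `*` `[0, 1]%classic) (tproj L (line s0), t0) by split.
  move=> /(_ ItT U Uk)[[X T] /= [Xs Tt] XT].
  have : nbhs (s0, t0) [set p : R * R | `[0, 1]%classic p.2 -> U (kappa p)].
    exists (line @^-1` (tproj L @^-1` X), T); first split => //=.
      by apply: line_cont; exact: (tproj_continuous Xs).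
    by move=> [s t] [/= Xt Tt'] It; apply: (XT (tproj L (line s), t)); split.
  move=> /near_dist[r r0 rU]; exists r => // p q [_ Ip] [_ Iq] /rU/(_ Ip)[a ac <-] /rU/(_ Iq)[b bc <-].
  exists (b - a); first exact: tproj_displacement.
  have := cmodD3 b c a; rewrite [cmod (c - a)]cmodB; move: ac bc => /=; lra.
have [e e0 eP] : exists2 e : R, 0 < e & forall s t : R, `[0, 1]%classic s -> `[0, 1]%classic t ->
    `|s - t| < e -> 4 * cmod (G (line t) - G (line s)) < m.
  apply: compact_locally_uniform; first exact: segment_compact.
  move=> s0 _; have Gl : {for s0, continuous (G \o line)}.
    by apply: continuous_comp; [exact: line_cont|exact: G_cont].
  have /continuous_cmodP/(_ _ m8)/near_dist[r r0 rP] := Gl.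
  exists r => // s t _ _ /rP /= sr /rP /= tr.
  have := cmodD3 (G (line t)) (G (line s0)) (G (line s)).
  by rewrite [cmod (G (line s0) - _)]cmodB; lra.
have [n nd ne] : exists2 n : nat, (n.+1%:R^-1 : R) < d & (n.+1%:R^-1 : R) < e.
  have de0 : 0 < Num.min d e by rewrite lt_min d0.
  have [n] := filter_ex (near_infty_natSinv_lt (PosNum de0)).
  by rewrite /= lt_min => /andP[nd ne]; exists n.
(* The grid divides the sides of the unit square in [n.+1] parts. *)
pose c (i : nat) : R := i%:R / n.+1%:R.
have n0 : 0 < n.+1%:R :> R by [].
have cI i : (i <= n.+1)%N -> `[0, 1]%classic (c i).
  move=> ltin; rewrite /= in_itv/= divr_ge0//= ler_pdivrMr// mul1r ler_nat.
  exact: ltin.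
have cS i : c i.+1 - c i = n.+1%:R^-1 by rewrite /c -mulrBl -natrB// subSnn mul1r.
have cSn i : `|c i - c i.+1| = n.+1%:R^-1 by rewrite distrC cS gtr0_norm// invr_gt0.
have c0 : c 0%N = 0 by rewrite /c mul0r.
have c1 : c n.+1 = 1 by rewrite /c divff// gt_eqF.
pose k i j := kappa (c i, c j).
have hstep i j : exists v, (i < n.+1)%N -> (j <= n.+1)%N ->
    displacement (k i j) (k i.+1 j) v /\ 4 * cmod v < m.
  have [ltin|] := boolP (i < n.+1)%N; last by exists 0.
  have [lejn|] := boolP (j <= n.+1)%N; last by exists 0.
  have [|||v vd vm] := dP (c i, c j) (c i.+1, c j).
  - by split; apply: cI => //; exact: ltnW.
  - by split; exact: cI.
  - by rewrite prod_normE/= subrr normr0 cSn gt_max nd d0.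
  by exists v.
have vstep i j : exists v, (i <= n.+1)%N -> (j < n.+1)%N ->
    displacement (k i j) (k i j.+1) v /\ 4 * cmod v < m.
  have [lein|] := boolP (i <= n.+1)%N; last by exists 0.
  have [ltjn|] := boolP (j < n.+1)%N; last by exists 0.
  have [|||v vd vm] := dP (c i, c j) (c i, c j.+1).
  - by split; apply: cI => //; exact: ltnW.
  - by split; exact: cI.
  - by rewrite prod_normE/= subrr normr0 cSn gt_max nd d0.
  by exists v.
pose a i := projT1 (choice (hstep i)); pose b i := projT1 (choice (vstep i)).
have ha i : _ := projT2 (choice (hstep i)); have hb i : _ := projT2 (choice (vstep i)).
have := grid_row_displacement (a := a) (b := b) disc ha hb.
have closed_rows j : (j <= n.+1)%N -> k 0%N j = k n.+1 j.
  by move=> _; rewrite /k /kappa /line c0 c1 mul0r mul1r addr0 (tprojD 0 Lw).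
move=> /(_ closed_rows).
have -> : \sum_(i < n.+1) a i n.+1 = period G w.
  have aG i : (i < n.+1)%N -> a i n.+1 = G (line (c i.+1)) - G (line (c i)).
    move=> ltin; have [da na] := ha i n.+1 ltin (leqnn _).
    have kG j : k j n.+1 = tproj M (G (line (c j))) by rewrite /k /kappa c1 H1 Gg.
    rewrite !kG in da; apply/eqP; rewrite -subr_eq0; apply/eqP/disc.
      exact: displacementB da (@tproj_displacement _ _ _ _).
    have := eP (c i) (c i.+1) (cI _ (ltnW ltin)) (cI _ ltin).
    rewrite cSn => /(_ ne); have := cmodD (a i n.+1) (- (G (line (c i.+1)) - G (line (c i)))).
    by rewrite cmodN; have := cmod_ge0 (a i n.+1); lra.
  rewrite (eq_bigr (fun i : 'I_n.+1 => G (line (c i.+1)) - G (line (c i)))); last first.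
    by move=> i _; exact: aG.
  rewrite -(big_mkord xpredT (fun i => G (line (c i.+1)) - G (line (c i)))) telescope_sumr//.
  by rewrite c0 c1 /line mul0r mul1r addr0 add0r.
move=> ->.
have a0 i : (i < n.+1)%N -> cmod (a i 0%N) <= K * (cmod w / n.+1%:R).
  move=> ltin; have [da na] := ha i 0%N ltin isT.
  rewrite (displacement_small disc da); last first.
    by have := cmod_ge0 (a i 0%N); lra.
  rewrite /k /kappa c0 !H0 (le_trans (phiK _ _))// ler_wpM2l//.
  rewrite (le_trans (flat_dist_le _ _ _))// cmodB /line opprD addrACA subrr add0r.
  by rewrite -mulrBl -rmorphB cmodM cmod_real cS gtr0_norm ?invr_gt0// mulrC.
have cmod_sum (r : seq 'I_n.+1) : cmod (\sum_(i <- r) a i 0%N) <= \sum_(i <- r) cmod (a i 0%N).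
  elim/big_rec2: _ => [|i x y _ xy]; first by rewrite cmod0.
  by rewrite (le_trans (cmodD _ _))// lerD2l.
have sum_a0 : \sum_(i < n.+1) cmod (a i 0%N) <= \sum_(i < n.+1) K * (cmod w / n.+1%:R).
  by apply: ler_sum => i _; exact: a0.
rewrite (le_trans (cmod_sum _))// (le_trans sum_a0)//.
by rewrite sumr_const card_ord -(mulr_natr (K * _)) -mulrA divfK// gt_eqF.
Qed.

End LipschitzPeriod.

(** * The affine map *)

Section AffineMap.
Variable R : realType.
Local Notation C := R[i].

Lemma Rcomplex_scaleE (a : R) (z : Rcomplex R) : a *: z = a%:C%C * (z : C) :> C.
Proof. by rewrite mulr_realE; case: z. Qed.

(** Straight segments between corresponding values of two lifts with the same
    periods form a homotopy. *)
Lemma lifts_homotopic (L M : lattice R) (f g : torus L -> torus M) (F G : C -> C) :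
  continuous F -> continuous G -> is_lift F f -> is_lift G g ->
  (forall z l, lattice_set L l -> F (z + l) - F z = G (z + l) - G z) ->
  homotopic R f g.
Proof.
move=> cF cG Ff Gg same_period.
pose Q (p : C * R) := F p.1 + p.2%:C%C * (G p.1 - F p.1).
exists (fun p => tproj M (Q (generic_quotient.repr p.1, p.2))).
have repr_lift x : tproj L (generic_quotient.repr x) = x.
  by rewrite /tproj generic_quotient.reprK.
split; last first.
- by move=> x; rewrite /Q mul1r addrC subrK -Gg repr_lift.
- by move=> x; rewrite /Q mul0r addr0 -Ff repr_lift.
apply: continuous_subspaceT; apply: (lift_homotopy_continuous (Q := Q)).
  have c1 : continuous (fun p : C * R => F p.1).
    by move=> p; apply: continuous_comp; [exact: cvg_fst|exact: cF].
  have c2 : continuous (fun p : C * R => G p.1).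
    by move=> p; apply: continuous_comp; [exact: cvg_fst|exact: cG].
  have c3 : continuous (fun p : C * R => p.2%:C%C : C).
    move=> p; apply: (@continuous_comp _ _ _ snd (real_complex R)); first exact: cvg_snd.
    have := @cst_plus_line_continuous R 0 1 p.2.
    by under [X in continuous_at _ X -> _]eq_fun do rewrite add0r mulr1.
  move=> p.
  exact: (continuousD (c1 p) (continuousM (c3 p) (continuousB (c2 p) (c1 p)))).
move=> z t; set w := generic_quotient.repr _.
have /tproj_eq Lwz : tproj L w = tproj L z by rewrite repr_lift.
apply/tproj_eq; have := same_period z _ Lwz; have := lift_period_mem Ff z Lwz.
rewrite [z + _]addrC subrK /Q /= => MF FG.
have -> : G w = F w - F z + G z by rewrite FG subrK.
by have -> : F w + t%:C%C * (F w - F z + G z - F w) - (F z + t%:C%C * (G z - F z)) = F w - F z by ring.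
Qed.

Lemma descend_homeo (L M : lattice R) (F Fi : C -> C) :
  continuous F -> continuous Fi -> cancel F Fi -> cancel Fi F ->
  (forall z l, lattice_set L l -> lattice_set M (F (z + l) - F z)) ->
  (forall z l, lattice_set M l -> lattice_set L (Fi (z + l) - Fi z)) ->
  exists h : homeo (torus L) (torus M), descend M F = h :> (torus L -> torus M).
Proof.
move=> cF cFi FK FiK perF perFi.
have lF := descend_lift perF; have lFi := descend_lift perFi.
have hK : cancel (descend M F) (descend L Fi).
  by move=> x; have [z <-] := tproj_surj x; rewrite lF lFi FK.
have hiK : cancel (descend L Fi) (descend M F).
  by move=> x; have [z <-] := tproj_surj x; rewrite lFi lF FiK.
by exists (Homeo hK hiK (lift_continuous cF lF) (lift_continuous cFi lFi)).
Qed.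

Variables (w1 w2 z1 z2 : C).
Hypotheses (w_indep : cross w1 w2 != 0).
Local Notation A := (change_basis w1 w2 z1 z2).

Lemma change_basisK : cross z1 z2 != 0 -> cancel A (change_basis z1 z2 w1 w2).
Proof.
move=> z_indep v; rewrite [A v]/change_basis change_basisD !change_basisZ.
by rewrite change_basis1// change_basis2// -[RHS](change_basis_id v w_indep).
Qed.

Lemma real_affine_change_basis : real_affine A.
Proof.
have linA : linear (A : Rcomplex R -> Rcomplex R).
  by move=> a u v; rewrite !Rcomplex_scaleE change_basisD change_basisZ.
pose l : {linear Rcomplex R -> Rcomplex R} :=
  HB.pack (A : Rcomplex R -> Rcomplex R) (GRing.isLinear.Build R (Rcomplex R) (Rcomplex R) *:%R A linA).
by exists l, 0 => z; rewrite addr0.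
Qed.

Lemma real_affine_unique (p : C -> C) :
  real_affine p -> p 0 = 0 -> p w1 = z1 -> p w2 = z2 -> p = A.
Proof.
move=> [l [b pE]] p0; have b0 : b = 0 by rewrite -p0 pE raddf0 add0r.
have {}pE z : p z = l z by rewrite pE b0 addr0.
move=> p1 p2; apply: change_basis_unique => // [u v|a v].
  by rewrite !pE; exact: (raddfD l).
by rewrite !pE; have := linearZ_LR l a (v : Rcomplex R); rewrite !Rcomplex_scaleE.
Qed.

(** A linear bound need only be checked on the lattice: up to scaling, the
    lattice points approximate every vector. *)
Lemma lattice_bound (L : lattice R) (K : R) :
  is_basis L w1 w2 -> 0 <= K ->
  (forall l, lattice_set L l -> cmod (A l) <= K * cmod l) ->
  forall v, cmod (A v) <= K * cmod v.
Proof.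
move=> bw K0 AK v; have [Lw1 Lw2] := basis_mem bw.
rewrite leNgt; apply/negP => KA.
pose c := K * (cmod w1 + cmod w2) + (cmod z1 + cmod z2).
have bounded (n : nat) : n%:R * (cmod (A v) - K * cmod v) <= c.
  pose a := n%:R * (cross v w2 / cross w1 w2).
  pose b := n%:R * (cross w1 v / cross w1 w2).
  (* [n v] is the sum of a lattice vector [l] and a bounded remainder [r]. *)
  pose l := w1 *~ Num.floor a + w2 *~ Num.floor b.
  pose s := a - (Num.floor a)%:~R; pose t := b - (Num.floor b)%:~R.
  pose r := s%:C%C * w1 + t%:C%C * w2.
  have frac (x : R) : `|x - (Num.floor x)%:~R| <= 1.
    have /andP[lex ltx] := floor_itv x.
    by rewrite ger0_norm ?subr_ge0// lerBlDl ltW// -[1]/(1%:~R) -intrD.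
  have Ll : lattice_set L l by apply: latticeD; exact: latticeMz.
  have nvE : n%:R%:C%C * v = l + r.
    rewrite -{1}(change_basis_id v w_indep) /change_basis mulrDr !mulrA -!rmorphM.
    rewrite -/a -/b /l /r /s /t !mulrz_real !rmorphB !mulrBl; ring.
  have r_le : cmod r <= cmod w1 + cmod w2.
    by rewrite (le_trans (cmodD _ _))// !cmodM !cmod_real lerD// ler_piMl ?cmod_ge0// frac.
  have Ar_le : cmod (A r) <= cmod z1 + cmod z2.
    rewrite change_basisD !change_basisZ change_basis1// change_basis2//.
    by rewrite (le_trans (cmodD _ _))// !cmodM !cmod_real lerD// ler_piMl ?cmod_ge0// frac.
  have n_norm u : n%:R * cmod u = cmod (n%:R%:C%C * u).
    by rewrite cmodM cmod_real ger0_norm.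
  have l_le : cmod l <= n%:R * cmod v + (cmod w1 + cmod w2).
    have -> : l = n%:R%:C%C * v - r by rewrite nvE addrK.
    by rewrite (le_trans (cmodD _ _))// cmodN -n_norm lerD2l.
  rewrite mulrBr lerBlDr n_norm -change_basisZ nvE change_basisD.
  rewrite (le_trans (cmodD _ _))//.
  have := AK l Ll; have := ler_wpM2l K0 l_le; rewrite mulrDr /c.
  by rewrite [n%:R * (K * _)]mulrCA; lra.
have gap : 0 < cmod (A v) - K * cmod v by rewrite subr_gt0.
have := bounded (Num.bound (c / (cmod (A v) - K * cmod v))).
rewrite leNgt => /negP; apply; rewrite -ltr_pdivrMr//.
apply: archi_boundP; apply: divr_ge0; last exact: ltW.
by rewrite addr_ge0 ?mulr_ge0 ?addr_ge0 ?cmod_ge0.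
Qed.

Lemma lift_lipschitz (L M : lattice R) (psi : torus L -> torus M) (K : R) :
  is_lift A psi -> 0 <= K -> (forall v, cmod (A v) <= K * cmod v) ->
  forall x y, flat_dist (psi x) (psi y) <= K * flat_dist x y.
Proof.
move=> Apsi K0 AK x y.
have rep_le z w : tproj L z = x -> tproj L w = y ->
    flat_dist (psi x) (psi y) <= K * cmod (z - w).
  move=> <- <-; rewrite !Apsi (le_trans (flat_dist_le _ _ _))//.
  by rewrite -change_basisB AK.
move: K0; rewrite le_eqVlt => /orP[/eqP K0|K0].
  have [z zx] := tproj_surj x; have [w wy] := tproj_surj y.
  by have := rep_le z w zx wy; rewrite -K0 !mul0r.
rewrite mulrC -ler_pdivrMr//; apply: le_flat_dist => z w zx wy.
by rewrite ler_pdivrMr// mulrC rep_le.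
Qed.

End AffineMap.

Theorem proposition3p3 (R : realType) (L L' : lattice R)
    (f : marking L) (f' : marking L')
    (area_L : has_area L 1) (area_L' : has_area L' 1)
    (w1 w2 z1 z2 : R[i]) (basis_w : is_basis L w1 w2)
    (w1_z1 : pi1_image (homeo_inv f' \o f) w1 z1)
    (w2_z2 : pi1_image (homeo_inv f' \o f) w2 z2) :
  is_basis L' z1 z2 /\
  exists (psi_lift : R[i] -> R[i]) (psi : torus L -> torus L'),
    [/\ unique (fun p : R[i] -> R[i] =>
          [/\ real_affine p, p 0 = 0, p w1 = z1 & p w2 = z2]) psi_lift,
        unique (is_lift psi_lift) psi,
        homotopic R psi (homeo_inv f' \o f),
        (exists h : homeo (torus L) (torus L'), psi = h) /\ lipschitz_map psi &
        forall phi : torus L -> torus L',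
          lipschitz_map phi ->
          homotopic R phi (homeo_inv f' \o f) ->
          (lipschitz_const psi <= lipschitz_const phi)%E].
Proof.
have [G [G_cont Gg G_onto]] := change_of_marking_lift f f'.
have [Lw1 Lw2] := basis_mem basis_w.
have z1E := pi1_image_period G_cont Gg Lw1 w1_z1.
have z2E := pi1_image_period G_cont Gg Lw2 w2_z2.
have basis_z : is_basis L' z1 z2.
  by rewrite z1E z2E; exact: period_basis G_cont Gg G_onto basis_w.
have w_indep := basis_cross basis_w; have z_indep := basis_cross basis_z.
pose A := change_basis w1 w2 z1 z2; pose B := change_basis z1 z2 w1 w2.
have A_period l : lattice_set L l -> A l = period G l.
  case: basis_w => _ -> [m [n ->]].
  rewrite (periodD G_cont Gg); last exact: latticeMz.
  rewrite !(periodMz G_cont Gg)// -z1E -z2E !mulrz_real.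
  by rewrite /A change_basisD !change_basisZ change_basis1// change_basis2.
have A_lattice z l : lattice_set L l -> lattice_set L' (A (z + l) - A z).
  move=> Ll; rewrite /A change_basisD -/A addrAC subrr add0r A_period//.
  exact: (period_mem Gg).
have [Lz1 Lz2] := basis_mem basis_z.
have B_lattice z l : lattice_set L' l -> lattice_set L (B (z + l) - B z).
  rewrite /B change_basisD addrAC subrr add0r.
  case: basis_z => _ -> [m [n ->]].
  rewrite !mulrz_real change_basisD !change_basisZ change_basis1// change_basis2//.
  by rewrite -!mulrz_real; apply: latticeD; exact: latticeMz.
have A_lift := descend_lift A_lattice.
have [K0 K0_ge0 AK0] := change_basis_bound z1 z2 w_indep.
have A_cont : continuous A by exact: change_basis_continuous.
have B_cont : continuous B by exact: change_basis_continuous.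
split=> //; exists A, (descend L' A); split.
- split.
    by split; [exact: real_affine_change_basis|exact: change_basis0|
      exact: change_basis1|exact: change_basis2].
  by move=> p [? ? ? ?]; apply/esym; exact: real_affine_unique.
- by split=> // psi; exact: is_lift_inj.
- apply: (lifts_homotopic A_cont G_cont A_lift Gg) => z l Ll.
  rewrite /A change_basisD -/A (lift_period G_cont Gg)// [LHS]addrAC [RHS]addrAC !subrr !add0r.
  exact: A_period.
- split.
    by apply: (@descend_homeo _ _ _ A B) => //; exact: change_basisK.
  have psi_K0 := lift_lipschitz A_lift K0_ge0 AK0.
  have psi_le := iffRL (@lipschitz_constP _ _ _ _ _ K0_ge0) psi_K0.
  exact: le_lt_trans psi_le (ltry _).
move=> phi phi_lip phi_g; apply: ge_ereal_sup => _ [x [y [xy ->]]].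
have phi_xy : ((flat_dist (phi x) (phi y) / flat_dist x y)%:E <= lipschitz_const phi)%E.
  by apply: ereal_sup_ubound; exists x, y.
move: phi_lip phi_xy; rewrite /lipschitz_map.
case E : (lipschitz_const phi) => [K| |] // _; rewrite lee_fin => phi_xy.
have K_ge0 : 0 <= K by rewrite (le_trans _ phi_xy)// divr_ge0// flat_dist_ge0.
have phiK : forall x y, flat_dist (phi x) (phi y) <= K * flat_dist x y.
  by apply: (iffLR (@lipschitz_constP _ _ _ _ _ K_ge0)); rewrite E.
rewrite lee_fin ler_pdivrMr; last exact: flat_dist_gt0.
apply: (lift_lipschitz A_lift K_ge0).
apply: (lattice_bound w_indep basis_w K_ge0) => l Ll.
by rewrite -/A A_period//; exact: lipschitz_period G_cont Gg phi_g phiK _ _ _.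
Qed.
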